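(* Let $(M_{0:n},G_{0:n})$ be a Feynman--Kac model with marginal measures $\gamma_{0:n}$, and consider the random-weight model $(M_{0:n},\bar G_{0:n})$ in which each $G_p$ is replaced by an unbiased estimate $\bar G_p$ of $G_p$, with particle approximation $\bar\gamma_n^N$ (random-weight model and asymptotic variance as defined in the context). Then for every bounded measurable $\varphi:\mathsf X\to\mathbb R$, the asymptotic variance of $\bar\gamma_n^N(\varphi)/\gamma_n(1)$ is $$\bar\sigma_n^2(\varphi)=\sum_{p=0}^n\bar v_{p,n}(\varphi),\qquad \bar v_{p,n}(\varphi)=\frac{\gamma_p(1)\,\gamma_p\big(s_p\cdot Q_{p,n}(\varphi)^2\big)}{\gamma_n(1)^2}-\eta_n(\varphi)^2,\quad p\in\{0,\dots,n\},$$ where $s_p(x_p)=\mathrm{var}\{\bar G_p(x_p)/G_p(x_p)\}+1$ for $p\in\{0,\dots,n-1\}$ and $s_n(x_n)=1$.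
   Context: Notation: for a measure $\mu$, a non-negative kernel $K$ and a measurable function $f$, $\mu(f)=\int f\,\mathrm d\mu$ and $K(f)(z)=\int f(x)K(z,\mathrm dx)$; $(\varphi\otimes 1)(x,u)=\varphi(x)$. Feynman--Kac model. On a measurable space $(\mathsf X,\mathcal X)$, $(M_{0:n},G_{0:n})$ consists of a probability measure $M_0$, Markov kernels $M_1,\dots,M_n$ and measurable potentials $G_p:\mathsf X\to(0,\infty)$, $p\in\{0,\dots,n\}$. Its predictive marginal measures are $\gamma_0=M_0$, $\gamma_p(S)=\int\gamma_{p-1}(\mathrm dx)G_{p-1}(x)M_p(x,S)$ for $p\in\{1,\dots,n\}$, and $\eta_p=\gamma_p/\gamma_p(1)$, with $\gamma_p(1)=\gamma_p(\mathsf X)$ finite. Set $Q_p(x_{p-1},\mathrm dx_p)=G_{p-1}(x_{p-1})M_p(x_{p-1},\mathrm dx_p)$ for $p\in\{1,\dots,n\}$, $Q_{p,n}=Q_{p+1}\cdots Q_n$ (composition of kernels) for $p\in\{0,\dots,n-1\}$, and $Q_{n,n}=\mathrm{Id}$ the identity kernel. For bounded $\varphi$, $Q_{p,n}(\varphi)$ is understood $\gamma_p$-almost everywhere. Particle approximation. The bootstrap particle filter samples $\zeta_0^{i}$ i.i.d. from $\eta_0$ ($i=1,\dots,N$) and, for $p=1,\dots,n$, independently for each $i$, an ancestor index $A_{p-1}^i$ with probabilities proportional to $(G_{p-1}(\zeta_{p-1}^j))_{j=1}^N$ and then $\zeta_p^i\sim M_p(\zeta_{p-1}^{A_{p-1}^i},\cdot)$.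 Then $\eta_p^N=\frac1N\sum_i\delta_{\zeta_p^i}$ and $\gamma_n^N=\{\prod_{t=0}^{n-1}\eta_t^N(G_t)\}\,\eta_n^N$. Asymptotic variance. For any Feynman--Kac model and bounded measurable $\varphi$, the asymptotic variance of $\gamma_n^N(\varphi)/\gamma_n(1)$ (the variance in the central limit theorem for $N^{1/2}\{\gamma_n^N(\varphi)-\gamma_n(\varphi)\}/\gamma_n(1)$ as $N\to\infty$) is by definition $$\sigma_n^2(\varphi)=\sum_{p=0}^n v_{p,n}(\varphi),\qquad v_{p,n}(\varphi)=\frac{\gamma_p(1)\gamma_p(Q_{p,n}(\varphi)^2)}{\gamma_n(1)^2}-\eta_n(\varphi)^2,$$ with values in $[0,\infty]$. Random-weight model. That $\bar G_p$ is an unbiased estimate of $G_p$ means: there are a measurable space $(\mathsf U,\mathcal U)$, Markov kernels $K_p$ from $\mathsf X$ to $\mathsf U$ and measurable functions $\tilde G_p:\mathsf X\times\mathsf U\to(0,\infty)$, $p\in\{0,\dots,n\}$, such that $\bar G_p(x_p)=\tilde G_p(x_p,U_p)$ with $U_p\sim K_p(x_p,\cdot)$ and $\int_{\mathsf U}\tilde G_p(x_p,u_p)K_p(x_p,\mathrm du_p)=G_p(x_p)$ for all $x_p\in\mathsf X$. The random-weight model is the Feynman--Kac model $(\tilde M_{0:n},\tilde G_{0:n})$ on $\mathsf X\times\mathsf U$, with $\tilde x_p=(x_p,u_p)$, $\tilde M_0(\mathrm d\tilde x_0)=M_0(\mathrm dx_0)K_0(x_0,\mathrm du_0)$ and $\tilde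 M_p(\tilde x_{p-1},\mathrm d\tilde x_p)=M_p(x_{p-1},\mathrm dx_p)K_p(x_p,\mathrm du_p)$. With $\tilde\gamma_n^N$ its particle approximation, $\bar\gamma_n^N(\varphi)=\tilde\gamma_n^N(\varphi\otimes1)$, and the asymptotic variance of $\bar\gamma_n^N(\varphi)/\gamma_n(1)$ is $\bar\sigma_n^2(\varphi):=\tilde\sigma_n^2(\varphi\otimes1)$, where $\tilde\sigma_n^2$ is the asymptotic variance above computed for $(\tilde M_{0:n},\tilde G_{0:n})$ (with $\bar v_{p,n}(\varphi)=\tilde v_{p,n}(\varphi\otimes1)$). The variance in $s_p(x_p)$ is that of $\tilde G_p(x_p,U_p)/G_p(x_p)$ with $x_p$ fixed and $U_p\sim K_p(x_p,\cdot)$. *)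

(* Defs.v *)
From HB Require Import structures.
From mathcomp Require Import all_boot all_order all_algebra.
From mathcomp Require Import mathcomp_extra boolp classical_sets functions.
From mathcomp Require Import cardinality fsbigop reals ereal interval_inference.
From mathcomp Require Import topology normedtype sequences esum measure.
From mathcomp Require Import measurable_realfun numfun lebesgue_measure.
From mathcomp Require Import lebesgue_integral kernel probability.
Set Implicit Arguments.
Unset Strict Implicit.
Unset Printing Implicit Defensive.
Import Order.TTheory GRing.Theory Num.Theory.
Import numFieldNormedType.Exports.

Local Open Scope classical_set_scope.
Local Open Scope ring_scope.
Local Open Scope ereal_scope.

(* The measure mu k : A |-> \int mu(dx) k(x, A).  The library's compositions
   ([kcomp], [kcomp_noparam]) carry a measure structure only for parameterized
   or subprobability kernels, whereas G M need not even be a finite kernel. *)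
Section mbind.
Context d d' (X : measurableType d) (Y : measurableType d') (R : realType).
Variables (mu : {measure set X -> \bar R}) (k : R.-ker X ~> Y).

Definition mbind (A : set Y) : \bar R := \int[mu]_x k x A.

Let mbind0 : mbind set0 = 0.
Proof. by apply: integral0_eq => x _; rewrite measure0. Qed.

Let mbind_ge0 A : 0 <= mbind A.
Proof. exact: integral_ge0. Qed.

Let mbind_sigma_additive : semi_sigma_additive mbind.
Proof.
move=> A mA tA mUA; rewrite [X in _ --> X](_ : _ =
  \int[mu]_x (\sum_(n <oo) k x (A n))); last first.
  apply: eq_integral => x _.
  by apply/esym/cvg_lim => //; exact/measure_semi_sigma_additive.
apply/cvg_closeP; split.
  by apply: is_cvg_nneseries => n _ _; exact: integral_ge0.
by rewrite closeE// integral_nneseries// => n; exact: measurable_kernel.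
Qed.

HB.instance Definition _ := isMeasure.Build _ _ _ mbind
  mbind0 mbind_ge0 mbind_sigma_additive.

End mbind.

Section kbind.
Context d0 d1 d2 (X : measurableType d0) (Y : measurableType d1)
  (Z : measurableType d2) (R : realType).
Variables (k1 : R.-ker X ~> Y) (k2 : R.-ker Y ~> Z).

Definition kbind (x : X) : {measure set Z -> \bar R} := mbind (k1 x) k2.

Let measurable_kbind A : measurable A ->
  measurable_fun [set: X] (kbind ^~ A).
Proof.
move=> mA; apply: (@measurable_fun_integral_kernel _ _ _ _ _ k1) => //.
- by move=> U mU; exact: measurable_kernel.
- exact: measurable_kernel.
Qed.

HB.instance Definition _ := isKernel.Build _ _ _ _ _ kbind measurable_kbind.

End kbind.

Section msemidirect.
Context d d' (X : measurableType d) (U : measurableType d') (R : realType).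
Variables (mu : {measure set X -> \bar R}) (K : R.-pker X ~> U).

(* mu(dx) K(x, du) *)
Definition msemidirect (A : set (X * U)) : \bar R :=
  \int[mu]_x K x (xsection A x).

Let msemidirect0 : msemidirect set0 = 0.
Proof. by apply: integral0_eq => x _; rewrite xsection0 measure0. Qed.

Let msemidirect_ge0 A : 0 <= msemidirect A.
Proof. exact: integral_ge0. Qed.

Let msemidirect_sigma_additive : semi_sigma_additive msemidirect.
Proof.
move=> A mA tA mUA; rewrite [X in _ --> X](_ : _ =
  \int[mu]_x (\sum_(n <oo) K x (xsection (A n) x))); last first.
  apply: eq_integral => x _; apply/esym/cvg_lim => //=; rewrite xsection_bigcup.
  apply: (measure_sigma_additive _ (trivIset_xsection tA)) => ?.
  exact: measurable_xsection.
apply/cvg_closeP; split.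
  by apply: is_cvg_nneseries => n _ _; exact: integral_ge0.
rewrite closeE// integral_nneseries// => n.
by apply: measurable_fun_xsection_finite_kernel; rewrite inE.
Qed.

HB.instance Definition _ := isMeasure.Build _ _ _ msemidirect
  msemidirect0 msemidirect_ge0 msemidirect_sigma_additive.

End msemidirect.

Section psemidirect.
Context d d' (X : measurableType d) (U : measurableType d') (R : realType).
Variables (mu : probability X R) (K : R.-pker X ~> U).

Definition psemidirect : set (X * U) -> \bar R := msemidirect mu K.

HB.instance Definition _ := Measure.on psemidirect.

Let psemidirectT : psemidirect setT = 1.
Proof.
rewrite /psemidirect /msemidirect (eq_integral (cst 1)).
  by rewrite integral_cst// mul1e; exact: probability_setT.
by move=> x _; rewrite xsectionE preimage_setT prob_kernel.
Qed.

HB.instance Definition _ :=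
  Measure_isProbability.Build _ _ _ psemidirect psemidirectT.

End psemidirect.

Section ksemidirect.
Context d0 d d' (Z : measurableType d0) (X : measurableType d)
  (U : measurableType d') (R : realType).
Variables (f : Z -> X) (M : R.-pker X ~> X) (K : R.-pker X ~> U).

(* z |-> M(f z, dx) K(x, du) *)
Definition ksemidirect (mf : measurable_fun [set: Z] f) (z : Z)
  : {measure set (X * U) -> \bar R} := msemidirect (M (f z)) K.

Hypothesis mf : measurable_fun [set: Z] f.

Let measurable_ksemidirect A : measurable A ->
  measurable_fun [set: Z] (ksemidirect mf ^~ A).
Proof.
move=> mA; apply: (@measurable_fun_integral_kernel _ _ _ _ _ (M \o f)) => //.
- by move=> B mB; exact: (measurableT_comp (measurable_kernel M _ mB) mf).
- by apply: measurable_fun_xsection_finite_kernel; rewrite inE.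
Qed.

HB.instance Definition _ :=
  isKernel.Build _ _ _ _ _ (ksemidirect mf) measurable_ksemidirect.

Let ksemidirect_prob z : ksemidirect mf z [set: X * U] = 1.
Proof.
rewrite /ksemidirect/= /msemidirect (eq_integral (cst 1)).
  by rewrite integral_cst// mul1e; exact: prob_kernel.
by move=> x _; rewrite xsectionE preimage_setT prob_kernel.
Qed.

HB.instance Definition _ :=
  Kernel_isProbability.Build _ _ _ _ _ (ksemidirect mf) ksemidirect_prob.

End ksemidirect.

Section kernel_probability.
Context d d' (X : measurableType d) (U : measurableType d') (R : realType).
Variables (K : R.-pker X ~> U) (x : X).

(* K(x, .) as an object of type [probability U R], as [variance] requires. *)
Definition kernel_probability : set U -> \bar R := K x.

HB.instance Definition _ := Measure.on kernel_probability.

HB.instance Definition _ :=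
  Measure_isProbability.Build _ _ _ kernel_probability (prob_kernel x).

End kernel_probability.

(* The families are indexed by [nat]; all time-n quantities below involve only
   M_1, ..., M_n and G_0, ..., G_n, and [fk_trans 0] is never used. *)
Record feynman_kac d (X : measurableType d) (R : realType) := FeynmanKac {
  fk_init : probability X R ;
  fk_trans : nat -> R.-pker X ~> X ;
  fk_pot : nat -> X -> R ;
  measurable_fk_pot : forall p, measurable_fun [set: X] (fk_pot p) ;
  fk_pot_gt0 : forall p x, (0 < fk_pot p x)%R }.

Section feynman_kac.
Context d (X : measurableType d) (R : realType).
Variable F : feynman_kac X R.

Definition fk_pot_nonneg p x : {nonneg R} :=
  NngNum (ltW (fk_pot_gt0 F p x)).

(* Q_p(x, dy) = G_{p-1}(x) M_p(x, dy), meaningful for p >= 1 *)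
Definition fk_Q (p : nat) (x : X) : {measure set X -> \bar R} :=
  mscale (fk_pot_nonneg p.-1 x) (fk_trans F p x).

Let measurable_fk_Q p A : measurable A ->
  measurable_fun [set: X] (fk_Q p ^~ A).
Proof.
move=> mA; apply: emeasurable_funM; last exact: measurable_kernel.
by apply/measurable_EFinP; exact: measurable_fk_pot.
Qed.

HB.instance Definition _ p :=
  isKernel.Build _ _ _ _ _ (fk_Q p) (@measurable_fk_Q p).

Fixpoint fk_gamma (p : nat) : {measure set X -> \bar R} :=
  if p is q.+1 then mbind (fk_gamma q) (fk_Q q.+1) else fk_init F.

(* Normalizing falls back on [fk_init F] when gamma_p(1) is 0 or infinite; the
   former cannot happen, and gamma_p(1) < +oo is a standing assumption that is
   not a field of the record. *)
Definition fk_eta (p : nat) : probability X R :=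
  mnormalize (fk_gamma p) (fk_init F).

(* Q_{p+1} ... Q_{p+m} *)
Fixpoint fk_Qiter (p m : nat) : R.-ker X ~> X :=
  if m is m'.+1 then kbind (fk_Q p.+1) (fk_Qiter p.+1 m')
  else kdirac (@measurable_id _ X [set: X]).

(* Q_{p,n}, for p <= n *)
Definition fk_Qpn (p n : nat) : R.-ker X ~> X := fk_Qiter p (n - p).

(* Q_{p,n}(phi)(x).  Where the positive and negative parts both integrate to
   +oo this is a junk value; that only happens on a gamma_p-null set when
   gamma_n(1) < +oo. *)
Definition fk_Qfun (p n : nat) (phi : X -> R) (x : X) : \bar R :=
  \int[fk_Qpn p n x]_y (phi y)%:E.

Definition fk_v (p n : nat) (phi : X -> R) : \bar R :=
  fk_gamma p [set: X] * (\int[fk_gamma p]_x (fk_Qfun p n phi x) ^+ 2)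
    / (fk_gamma n [set: X]) ^+ 2
  - (\int[fk_eta n]_x (phi x)%:E) ^+ 2.

(* sigma_n^2(phi) *)
Definition fk_asymptotic_variance (n : nat) (phi : X -> R) : \bar R :=
  \sum_(p < n.+1) fk_v p n phi.

End feynman_kac.

Record random_weight d d' (X : measurableType d) (U : measurableType d')
    (R : realType) := RandomWeight {
  rw_ker : nat -> R.-pker X ~> U ;
  rw_pot : nat -> X * U -> R ;
  measurable_rw_pot : forall p, measurable_fun [set: X * U] (rw_pot p) ;
  rw_pot_gt0 : forall p z, (0 < rw_pot p z)%R }.

Section random_weight_model.
Context d d' (X : measurableType d) (U : measurableType d') (R : realType).
Variables (F : feynman_kac X R) (W : random_weight X U R).

Definition rw_unbiased (n : nat) : Prop :=
  forall p, (p <= n)%N -> forall x : X,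
    \int[rw_ker W p x]_u (rw_pot W p (x, u))%:E = (fk_pot F p x)%:E.

Definition rw_model : feynman_kac (X * U)%type R :=
  @FeynmanKac _ _ _
    (psemidirect (fk_init F) (rw_ker W 0))
    (fun p => ksemidirect (fk_trans F p) (rw_ker W p) (@measurable_fst _ _ X U))
    (rw_pot W) (@measurable_rw_pot _ _ _ _ _ W) (@rw_pot_gt0 _ _ _ _ _ W).

Definition rw_v (p n : nat) (phi : X -> R) : \bar R :=
  fk_v rw_model p n (phi \o fst).

Definition rw_asymptotic_variance (n : nat) (phi : X -> R) : \bar R :=
  fk_asymptotic_variance rw_model n (phi \o fst).

(* s_p, with s_n = 1 at the terminal time; the variance may be +oo *)
Definition rw_s (n p : nat) (x : X) : \bar R :=
  if (p < n)%N then
    variance (kernel_probability (rw_ker W p) x)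
      (fun u => rw_pot W p (x, u) / fk_pot F p x)%R + 1
  else 1.

End random_weight_model.

(* Main.v *)
(* Write r(x, u) = G~_p(x, u) / G_p(x).  Unbiasedness of the weights gives
   gamma~_p(dx, du) = gamma_p(dx) K_p(x, du), and, for p < n,
   Q~_{p,n}(phi (x) 1)(x, u) = r(x, u) Q_{p,n}(phi)(x): every random weight
   after time p is averaged out, while the one at time p factors out.  Squaring
   and integrating over u yields the factor E[r(x, U)^2], which is
   var(r(x, U)) + 1 because r(x, U) has mean 1. *)
Require Import Defs.
From HB Require Import structures.
From mathcomp Require Import all_boot all_order all_algebra.
From mathcomp Require Import mathcomp_extra boolp classical_sets functions.
From mathcomp Require Import cardinality fsbigop reals ereal interval_inference.
From mathcomp Require Import topology normedtype sequences esum measure.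
From mathcomp Require Import measurable_realfun numfun lebesgue_measure.
From mathcomp Require Import lebesgue_integral kernel probability.
From mathcomp Require Import zify ring lra.
Import Order.TTheory GRing.Theory Num.Theory.
Import numFieldNormedType.Exports.

Local Open Scope classical_set_scope.
Local Open Scope ring_scope.
Local Open Scope ereal_scope.

Import HBNNSimple.

(** * Integration against mixtures of measures *)

(** [nuE] is the case of indicators; linearity gives simple functions, and monotone convergence
    along [nnsfun_approx] gives the rest. Both [mbind] and [msemidirect] are mixtures of this
    kind. *)
Lemma ge0_integral_mixture d d' (X : measurableType d) (Y : measurableType d')
    (R : realType) (mu : {measure set X -> \bar R})
    (nu : {measure set Y -> \bar R}) (l : X -> {measure set Y -> \bar R})
    (ml : forall A, measurable A -> measurable_fun [set: X] (l ^~ A))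
    (nuE : forall A, measurable A -> nu A = \int[mu]_x l x A)
    (f : Y -> \bar R) :
  (forall y, 0 <= f y) -> measurable_fun [set: Y] f ->
  \int[nu]_y f y = \int[mu]_x \int[l x]_y f y.
Proof.
move=> f0 mf; pose g := nnsfun_approx measurableT mf; pose gE n := EFin \o g n.
have mg n : measurable_fun [set: Y] (gE n) by exact/measurable_EFinP.
have g0 n y : 0 <= gE n y by rewrite lee_fin.
have ndg y : {homo gE ^~ y : m n / (m <= n)%O >-> m <= n}.
  by move=> *; exact/lefP/nd_nnsfun_approx.
(* The measure is left arbitrary because this is used for [nu] and for every [l x]. *)
have cvgg (m : {measure set Y -> \bar R}) :
    \int[m]_y f y = limn (fun n => \int[m]_y gE n y).
  rewrite -[RHS]monotone_convergence//; apply: eq_integral => y _.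
  by apply/esym/cvg_lim => //; exact: cvg_nnsfun_approx.
have sintE n : \int[nu]_y gE n y = \int[mu]_x \int[l x]_y gE n y.
  rewrite integralT_nnsfun sintegralE.
  under [RHS]eq_integral do rewrite integralT_nnsfun sintegralE.
  rewrite ge0_integral_fsum//; last 2 first.
    by move=> r; apply: measurable_funeM; exact: ml.
    by move=> r x _; exact: nnsfun_mulemu_ge0.
  (* Writing [r] as an attained value [g n y] supplies the sign needed to move it out of the
     integral. *)
  apply: eq_fsbigr => r /set_mem[y _ <-].
  by rewrite ge0_integralZl ?nuE//; [exact: ml | exact: g0].
rewrite cvgg; under eq_fun do rewrite sintE.
rewrite -[LHS]monotone_convergence//; last 3 first.
- by move=> n; exact: measurable_fun_integral_kernel.
- by move=> n x _; exact: integral_ge0.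
- by move=> x _ m n mn; apply: ge0_le_integral => // y _; exact: ndg.
by apply: eq_integral => x _; rewrite cvgg.
Qed.


Lemma integral_mbind d d' (X : measurableType d) (Y : measurableType d')
    (R : realType) (mu : {measure set X -> \bar R}) (k : R.-ker X ~> Y)
    (f : Y -> \bar R) :
  (forall y, 0 <= f y) -> measurable_fun [set: Y] f ->
  \int[mbind mu k]_y f y = \int[mu]_x \int[k x]_y f y.
Proof. by apply: ge0_integral_mixture => // A mA; exact: measurable_kernel. Qed.

Lemma integral_msemidirect d d' (X : measurableType d) (U : measurableType d')
    (R : realType) (mu : {measure set X -> \bar R}) (K : R.-pker X ~> U)
    (f : X * U -> \bar R) :
  (forall z, 0 <= f z) -> measurable_fun [set: X * U] f ->
  \int[msemidirect mu K]_z f z = \int[mu]_x \int[K x]_u f (x, u).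
Proof.
move=> f0 mf.
have mid : measurable_fun [set: X] (@id X) by exact: measurable_id.
(* [l x] is the product of the Dirac mass at [x] with [K x]. Building it with [ksemidirect] provides
   its measurability in [x]. *)
pose l := ksemidirect (kdirac mid) K mid.
have lE x A : measurable A -> l x A = K x (xsection A x).
  move=> mA; rewrite /l /= /ksemidirect /= /msemidirect integral_dirac//.
    by rewrite diracT mul1e.
  by apply: measurable_fun_xsection_finite_kernel; rewrite inE.
rewrite (@ge0_integral_mixture _ _ _ _ _ mu _ l)//; first last.
- by move=> A mA; apply: eq_integral => x _; rewrite lE.
- by move=> A mA; exact: measurable_kernel.
apply: eq_integral => x _.
(* [l x] is also the image of [K x] under [u |-> (x, u)]. *)
rewrite -(ge0_integral_pushforward (pair1_measurable x) (K x) measurableT mf)//.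
by apply: eq_measure_integral => A mA _; rewrite lE// xsectionE.
Qed.

Lemma measurable_kernel_integral d d' (X : measurableType d)
    (Y : measurableType d') (R : realType) (k : R.-ker X ~> Y)
    (f : Y -> \bar R) :
  (forall y, 0 <= f y) -> measurable_fun [set: Y] f ->
  measurable_fun [set: X] (fun x => \int[k x]_y f y).
Proof.
by move=> f0 mf; apply: measurable_fun_integral_kernel => // A mA;
  exact: measurable_kernel.
Qed.

(** * One-step recursions for a Feynman-Kac model *)

Section feynman_kac_integrals.
Context d (X : measurableType d) (R : realType) (F : feynman_kac X R).
Implicit Types f : X -> \bar R.

Lemma integral_fk_Q p x f :
  (forall y, 0 <= f y) -> measurable_fun [set: X] f ->
  \int[fk_Q F p.+1 x]_y f y =
  (fk_pot F p x)%:E * \int[fk_trans F p.+1 x]_y f y.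
Proof. by move=> f0 mf; rewrite ge0_integral_mscale. Qed.

Lemma integral_fk_gammaS p f :
  (forall y, 0 <= f y) -> measurable_fun [set: X] f ->
  \int[fk_gamma F p.+1]_y f y =
  \int[fk_gamma F p]_x ((fk_pot F p x)%:E * \int[fk_trans F p.+1 x]_y f y).
Proof.
move=> f0 mf; rewrite integral_mbind//.
by apply: eq_integral => x _; rewrite integral_fk_Q.
Qed.

Lemma integral_fk_Qiter0 p x f : measurable_fun [set: X] f ->
  \int[fk_Qiter F p 0 x]_y f y = f x.
Proof. by move=> mf; rewrite integral_dirac// diracT mul1e. Qed.

Lemma integral_fk_QiterS p m x f :
  (forall y, 0 <= f y) -> measurable_fun [set: X] f ->
  \int[fk_Qiter F p m.+1 x]_y f y =
  (fk_pot F p x)%:E *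
    \int[fk_trans F p.+1 x]_y \int[fk_Qiter F p.+1 m y]_z f z.
Proof.
move=> f0 mf; rewrite integral_mbind// integral_fk_Q//.
- by move=> y; exact: integral_ge0.
- exact: measurable_kernel_integral.
Qed.

Lemma fk_Qfunnn n (phi : X -> R) x : measurable_fun [set: X] phi ->
  fk_Qfun F n n phi x = (phi x)%:E.
Proof.
move=> /measurable_EFinP mphi.
by rewrite /fk_Qfun /fk_Qpn subnn integral_fk_Qiter0.
Qed.

Lemma measurable_fk_Qfun p n (phi : X -> R) :
  measurable_fun [set: X] phi -> measurable_fun [set: X] (fk_Qfun F p n phi).
Proof.
move=> /measurable_EFinP mphi; rewrite /fk_Qfun.
under eq_fun do rewrite integralE.
apply: emeasurable_funB; apply: measurable_kernel_integral => //.
- exact: measurable_funepos.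
- exact: measurable_funeneg.
Qed.

End feynman_kac_integrals.

(* Unlike [muleDr], this also covers [x + y = +oo - oo = -oo]. *)
Lemma pmuleDr (R : realDomainType) (r : R) (x y : \bar R) : (0 < r)%R ->
  r%:E * (x + y) = r%:E * x + r%:E * y.
Proof.
move=> r0; have [xy|] := boolP (x +? y); first by rewrite muleDr.
by case: x y => [x||] [y||]//= _; rewrite gt0_muley ?gt0_muleNy ?lte_fin.
Qed.

Lemma measurable_pker_integral d d' (X : measurableType d)
    (U : measurableType d') (R : realType) (K : R.-pker X ~> U)
    (f : X * U -> \bar R) :
  (forall z, 0 <= f z) -> measurable_fun [set: X * U] f ->
  measurable_fun [set: X] (fun x => \int[K x]_u f (x, u)).
Proof. exact: measurable_fun_integral_finite_kernel. Qed.

(** The second moment may be infinite, so the square is not expanded under the integral: the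
    expansion is rearranged so that nothing is subtracted, and the constants are cancelled at the
    end. *)
Lemma variance_mean1 d (U : measurableType d) (R : realType)
    (P : probability U R) (Z : U -> R) :
  measurable_fun [set: U] Z -> (forall u, 0 <= Z u)%R ->
  \int[P]_u (Z u)%:E = 1 ->
  variance P Z + 1 = \int[P]_u (Z u ^+ 2)%:E.
Proof.
move=> mZ Z0 EZ.
have mZE : measurable_fun [set: U] (EFin \o Z) by exact/measurable_EFinP.
have VE : variance P Z = \int[P]_u ((Z u - 1) ^+ 2)%:E.
  by rewrite /variance unlock unlock EZ; apply: eq_integral => u _;
    rewrite expr2.
have mV : measurable_fun [set: U] (fun u => ((Z u - 1) ^+ 2)%:E).
  apply/measurable_EFinP; apply: measurable_funX.
  exact: measurable_funB.
have mS : measurable_fun [set: U] (fun u => (Z u ^+ 2)%:E).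
  by apply/measurable_EFinP; exact: measurable_funX.
(* (Z - 1)^2 + 2 Z = Z^2 + 1, both sides being sums of nonnegative terms *)
have : variance P Z + 2%:E = \int[P]_u (Z u ^+ 2)%:E + 1.
  have <- : \int[P]_u (2%:E * (Z u)%:E) = 2%:E.
    by rewrite ge0_integralZl// ?EZ ?mule1// => u _; rewrite lee_fin.
  have <- : \int[P]_u (cst 1 u) = 1 :> \bar R.
    by rewrite integral_cst// mul1e; exact: probability_setT.
  rewrite VE -!ge0_integralD//.
  - by apply: eq_integral => u _; rewrite -EFinM -!EFinD; congr EFin; ring.
  - by move=> u _; rewrite lee_fin sqr_ge0.
  - by move=> u _; rewrite lee_fin sqr_ge0.
  - by move=> u _; rewrite mule_ge0// lee_fin.
  - exact: measurable_funeM.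
have : 0 <= variance P Z.
  by rewrite VE integral_ge0// => u _; rewrite lee_fin sqr_ge0.
have : 0 <= \int[P]_u (Z u ^+ 2)%:E.
  by rewrite integral_ge0// => u _; rewrite lee_fin sqr_ge0.
(* The signs exclude [-oo], and the identity excludes one side finite with the other infinite; only
   the finite case needs arithmetic. *)
case: (variance P Z) => [v||]//; case: (\int[P]_u _) => [s||]// _ _.
by rewrite -!EFinD => -[vs]; congr EFin; lra.
Qed.

(** * Random-weight model: marginal measures *)

Section random_weight_integrals.
Context d d' (X : measurableType d) (U : measurableType d') (R : realType).
Variables (F : feynman_kac X R) (W : random_weight X U R) (n : nat).
Hypothesis W_unbiased : rw_unbiased F W n.

Lemma measurable_rw_pot_section p x :
  measurable_fun [set: U] (fun u => (rw_pot W p (x, u))%:E).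
Proof.
apply/measurable_EFinP; apply: measurableT_comp (pair1_measurable x).
exact: measurable_rw_pot.
Qed.

Lemma integral_rw_trans p z (f : X * U -> \bar R) :
  (forall z, 0 <= f z) -> measurable_fun [set: X * U] f ->
  \int[fk_trans (rw_model F W) p z]_z' f z' =
  \int[fk_trans F p z.1]_x \int[rw_ker W p x]_u f (x, u).
Proof. exact: integral_msemidirect. Qed.

(** Unbiasedness in the form the recursions use: [c] stands for an integral over later coordinates,
    which does not depend on [u] and may be infinite. *)
Lemma integral_rw_potZ p x (c : \bar R) : (p <= n)%N -> 0 <= c ->
  \int[rw_ker W p x]_u ((rw_pot W p (x, u))%:E * c) = (fk_pot F p x)%:E * c.
Proof.
move=> pn c0; rewrite ge0_integralZr ?W_unbiased//.
- exact: measurable_rw_pot_section.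
- by move=> u _; rewrite lee_fin ltW// rw_pot_gt0.
Qed.

(** Induction on [p]: the transition out of [(x, u)] depends on [x] alone, so [u] enters only
    through the weight, whose mean given [x] is [fk_pot F p x]. *)
Lemma integral_rw_gamma p (f : X * U -> \bar R) : (p <= n)%N ->
  (forall z, 0 <= f z) -> measurable_fun [set: X * U] f ->
  \int[fk_gamma (rw_model F W) p]_z f z =
  \int[fk_gamma F p]_x \int[rw_ker W p x]_u f (x, u).
Proof.
elim: p f => [|p IHp] f pn f0 mf; first exact: integral_msemidirect.
pose g x := \int[rw_ker W p.+1 x]_u f (x, u).
have g0 x : 0 <= g x by exact: integral_ge0.
have mg : measurable_fun [set: X] g by exact: measurable_pker_integral.
have mh := @measurable_kernel_integral _ _ _ _ _ (fk_trans F p.+1) _ g0 mg.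
rewrite !integral_fk_gammaS//.
under eq_integral do rewrite integral_rw_trans//.
(* The induction hypothesis is applied to the time-[p] weight times the integral of [g] under
   [fk_trans F p.+1]. *)
rewrite IHp; last first.
- apply: emeasurable_funM.
    by apply/measurable_EFinP; exact: measurable_rw_pot.
  exact: measurableT_comp mh measurable_fst.
- move=> z; apply: mule_ge0; last by apply: integral_ge0 => x _; exact: g0.
  by rewrite lee_fin ltW//; exact: rw_pot_gt0.
- exact: ltnW.
apply: eq_integral => x _ /=; rewrite -integral_rw_potZ//; first exact: ltnW.
by apply: integral_ge0 => y _; exact: g0.
Qed.

Lemma rw_gamma_fst p A : (p <= n)%N -> measurable A ->
  fk_gamma (rw_model F W) p (fst @^-1` A) = fk_gamma F p A.
Proof.
move=> pn mA.
have mfA : measurable (fst @^-1` A : set (X * U)).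
  by rewrite -[_ @^-1` _]setTI; exact: measurable_fst.
rewrite -[fst @^-1` A]setIT -integral_indic//.
rewrite integral_rw_gamma//; last first.
  exact/measurable_EFinP.
rewrite -[in RHS](setIT A) -integral_indic//; apply: eq_integral => x _.
transitivity (\int[rw_ker W p x]_u (cst (\1_A x)%:E) u).
  exact: eq_integral.
by rewrite integral_cst// prob_kernel mule1.
Qed.

Lemma rw_gammaT p : (p <= n)%N ->
  fk_gamma (rw_model F W) p [set: X * U] = fk_gamma F p [set: X].
Proof. by move=> pn; rewrite -rw_gamma_fst// preimage_setT. Qed.

Lemma rw_eta_fst p A : (p <= n)%N -> measurable A ->
  fk_eta (rw_model F W) p (fst @^-1` A) = fk_eta F p A.
Proof.
move=> pn mA; rewrite /fk_eta /= /mnormalize rw_gammaT//.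
(* In the fallback branch of [mnormalize] both sides are initial laws, so it remains to see that the
   first marginal of [psemidirect] is [fk_init F]. *)
case: ifPn => _; last by rewrite rw_gamma_fst.
rewrite /psemidirect /msemidirect.
transitivity (\int[fk_init F]_x (\1_A x)%:E); last first.
  by rewrite integral_indic// setIT.
apply: eq_integral => x _.
have -> : xsection (fst @^-1` A) x = if x \in A then [set: U] else set0.
  rewrite xsectionE -comp_preimage; apply/seteqP.
  by split=> u /=; case: ifPn; rewrite ?inE ?notin_setE.
by rewrite indicE; case: ifPn; rewrite ?measure0 ?prob_kernel.
Qed.

Lemma integral_rw_eta p (phi : X -> R) : (p <= n)%N ->
  measurable_fun [set: X] phi ->
  \int[fk_eta (rw_model F W) p]_z (phi z.1)%:E = \int[fk_eta F p]_x (phi x)%:E.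
Proof.
move=> pn /measurable_EFinP mphi.
(* Change of variables along [fst] for non-negative functions, to be applied to the two parts of
   [phi] separately. *)
have pushE (g : X -> \bar R) : (forall x, 0 <= g x) -> measurable_fun setT g ->
    \int[fk_eta (rw_model F W) p]_z (g \o fst) z = \int[fk_eta F p]_x g x.
  move=> g0 mg.
  rewrite -(ge0_integral_pushforward measurable_fst _ measurableT mg)//.
  by apply: eq_measure_integral => A mA _; exact: rw_eta_fst.
rewrite integralE [RHS]integralE.
rewrite -(pushE (EFin \o phi)^\+)//; last exact: measurable_funepos.
rewrite -(pushE (EFin \o phi)^\-)//; last exact: measurable_funeneg.
by rewrite -funepos_comp -funeneg_comp.
Qed.

(** * Random-weight model: the iterated kernels *)

Lemma integral_rw_ratioZ p x (c : \bar R) : (p <= n)%N -> 0 <= c ->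
  \int[rw_ker W p x]_u ((rw_pot W p (x, u) / fk_pot F p x)%:E * c) = c.
Proof.
move=> pn c0; have G0 : (fk_pot F p x != 0)%R by rewrite gt_eqF// fk_pot_gt0.
under eq_integral do rewrite EFinM -muleA.
rewrite integral_rw_potZ//.
  by rewrite muleA -EFinM divff// mul1e.
by rewrite mule_ge0// lee_fin invr_ge0 ltW// fk_pot_gt0.
Qed.

Lemma integral_rw_QiterS p m z (f : X * U -> \bar R) :
  (forall z, 0 <= f z) -> measurable_fun [set: X * U] f ->
  \int[fk_Qiter (rw_model F W) p m.+1 z]_z' f z' =
  (rw_pot W p z)%:E * \int[fk_trans F p.+1 z.1]_x \int[rw_ker W p.+1 x]_u
    \int[fk_Qiter (rw_model F W) p.+1 m (x, u)]_z' f z'.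
Proof.
move=> f0 mf; rewrite integral_fk_QiterS// integral_rw_trans//.
- by move=> z'; exact: integral_ge0.
- exact: measurable_kernel_integral.
Qed.

(** At least one step is taken, since the zero-step iterate is the identity and carries no weight.
    Induction on [m]: the ratio at time [p.+1] produced by the shorter iterate has mean 1 and
    disappears. *)
Lemma integral_rw_Qiter p m z (f : X -> \bar R) : (p + m < n)%N ->
  (forall x, 0 <= f x) -> measurable_fun [set: X] f ->
  \int[fk_Qiter (rw_model F W) p m.+1 z]_z' f z'.1 =
  (rw_pot W p z / fk_pot F p z.1)%:E * \int[fk_Qiter F p m.+1 z.1]_x f x.
Proof.
move=> + f0 mf; have mff := measurableT_comp mf (@measurable_fst _ _ X U).
elim: m p z => [|m IHm] p z pmn; rewrite integral_rw_QiterS//.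
(* The potential produced by the first step of the original model cancels the denominator, leaving
   [rw_pot W p z] on both sides. *)
all: rewrite integral_fk_QiterS// muleA -EFinM divfK ?gt_eqF ?fk_pot_gt0//.
all: congr (_ * _).
all: apply: eq_integral => x _.
- under eq_integral do rewrite integral_fk_Qiter0//.
  rewrite integral_fk_Qiter0//= integral_cst// prob_kernel.
  by rewrite mule1.
- under eq_integral do rewrite IHm ?addSnnS//.
  by rewrite /= integral_rw_ratioZ//; [lia | exact: integral_ge0].
Qed.

Lemma rw_QfunE p (phi : X -> R) z : (p < n)%N ->
  measurable_fun [set: X] phi ->
  fk_Qfun (rw_model F W) p n (phi \o fst) z =
  (rw_pot W p z / fk_pot F p z.1)%:E * fk_Qfun F p n phi z.1.
Proof.
move=> pn /measurable_EFinP mphi; rewrite /fk_Qfun /fk_Qpn.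
have -> : (n - p = (n - p).-1.+1)%N by rewrite prednK// subn_gt0.
have pmn : (p + (n - p).-1 < n)%N by rewrite -subn1; lia.
set r := (_ / _)%R.
have r0 : (0 < r)%R by rewrite divr_gt0 ?rw_pot_gt0 ?fk_pot_gt0.
rewrite integralE [in RHS]integralE.
(* Reassociating the composition exhibits both parts as functions of the first coordinate only. *)
rewrite -[X in X^\+]/((EFin \o phi) \o fst) -[X in X^\-]/((EFin \o phi) \o fst).
rewrite funepos_comp funeneg_comp !integral_rw_Qiter//; last 2 first.
- exact: measurable_funeneg.
- exact: measurable_funepos.
(* The two parts may both have infinite integral at [z]; a factor that is finite and positive still
   distributes. *)
by rewrite [RHS]pmuleDr// [in RHS]muleN.
Qed.

(** * Random-weight model: second moments and variance terms *)

Lemma rw_sE p x : (p < n)%N ->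
  rw_s F W n p x =
  \int[rw_ker W p x]_u ((rw_pot W p (x, u) / fk_pot F p x) ^+ 2)%:E.
Proof.
move=> pn; rewrite /rw_s pn; apply: variance_mean1.
- apply: measurable_funM => //.
  by apply/measurable_EFinP; exact: measurable_rw_pot_section.
- by move=> u; rewrite divr_ge0 ?ltW ?rw_pot_gt0 ?fk_pot_gt0.
- have := integral_rw_ratioZ p x 1 (ltnW pn) lee01.
  by under eq_integral do rewrite mule1.
Qed.

Lemma integral_rw_Qfun2 p (phi : X -> R) : (p <= n)%N ->
  measurable_fun [set: X] phi ->
  \int[fk_gamma (rw_model F W) p]_z
    (fk_Qfun (rw_model F W) p n (phi \o fst) z) ^+ 2 =
  \int[fk_gamma F p]_x (rw_s F W n p x * (fk_Qfun F p n phi x) ^+ 2).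
Proof.
move=> pn mphi.
have mQ : measurable_fun [set: X * U]
    (fk_Qfun (rw_model F W) p n (phi \o fst)).
  by apply: measurable_fk_Qfun; exact: measurableT_comp mphi measurable_fst.
rewrite integral_rw_gamma//; first last.
- exact: emeasurable_funM.
- by move=> z; exact: sqre_ge0.
(* At [p = n] the kernel is the identity and no time-[n] weight enters, whence the value 1 of
   [rw_s]. For [p < n] the squared ratio is integrated over [u] while the squared [fk_Qfun] factor
   is constant in [u]. *)
apply: eq_integral => x _; move: pn; rewrite leq_eqVlt => /predU1P[->|pn].
- rewrite /rw_s ltnn mul1e.
  have mphi1 := measurableT_comp mphi (@measurable_fst _ _ X U).
  under eq_integral do rewrite fk_Qfunnn//.
  by rewrite fk_Qfunnn//= integral_cst// prob_kernel mule1.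
- under eq_integral do rewrite rw_QfunE// expe2 muleACA -EFinM -expr2.
  rewrite /= ge0_integralZr ?rw_sE ?sqre_ge0//.
  + apply/measurable_EFinP; apply: measurable_funX.
    apply: measurable_funM => //.
    by apply/measurable_EFinP; exact: measurable_rw_pot_section.
  + by move=> u _; rewrite lee_fin sqr_ge0.
Qed.

Lemma rw_vE p (phi : X -> R) : (p <= n)%N -> measurable_fun [set: X] phi ->
  rw_v F W p n phi =
  fk_gamma F p [set: X]
    * (\int[fk_gamma F p]_x (rw_s F W n p x * (fk_Qfun F p n phi x) ^+ 2))
    / (fk_gamma F n [set: X]) ^+ 2
  - (\int[fk_eta F n]_x (phi x)%:E) ^+ 2.
Proof.
move=> pn mphi; rewrite /rw_v /fk_v integral_rw_Qfun2// integral_rw_eta//.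
by rewrite !rw_gammaT.
Qed.

End random_weight_integrals.

Theorem proposition3p2 (R : realType) (d d' : measure_display)
  (X : measurableType d) (U : measurableType d') (n : nat)
  (F : feynman_kac X R)
  (F_fin : forall p, (p <= n)%N -> fk_gamma F p [set: X] < +oo)
  (W : random_weight X U R) (W_unbiased : rw_unbiased F W n)
  (phi : X -> R) (mphi : measurable_fun [set: X] phi)
  (bphi : exists c : R, forall x : X, (`|phi x| <= c)%R) :
  let vbar (p : nat) : \bar R :=
    fk_gamma F p [set: X]
      * (\int[fk_gamma F p]_x (rw_s F W n p x * (fk_Qfun F p n phi x) ^+ 2))
      / (fk_gamma F n [set: X]) ^+ 2
    - (\int[fk_eta F n]_x (phi x)%:E) ^+ 2 in
  rw_asymptotic_variance F W n phi = \sum_(p < n.+1) vbar p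
  /\ forall p : nat, (p <= n)%N -> rw_v F W p n phi = vbar p.
Proof.
move=> vbar.
have vE p : (p <= n)%N -> rw_v F W p n phi = vbar p by move=> pn; exact: rw_vE.
(* The asymptotic variance is by definition the sum of the [rw_v], so the terms are compared one by
   one. *)
by split=> //; apply: eq_bigr => p _; apply: vE; rewrite -ltnS.
Qed.
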